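(* Let $e>2$, and let $H=\langle a, a+d, \dots, a+(e-1)d\rangle$ with $a,d$ coprime nonnegative integers and $e\leq a$. Then: (a) $H$ is nearly Gorenstein; (b) $H$ is symmetric if and only if $a\equiv 2 \pmod{e-1}$; (c) $H$ is almost symmetric if and only if $a=e$ or $a\equiv 2 \pmod{e-1}$.
   Context: A numerical semigroup $H$ is a submonoid of $(\mathbb{N},+)$ (with $0\in\mathbb{N}$) such that $\mathbb{N}\setminus H$ is finite; $\langle n_1,\dots,n_e\rangle$ denotes the submonoid of $\mathbb{N}$ generated by $n_1,\dots,n_e$. $M=H\setminus\{0\}$. The elements of $G(H)=\mathbb{N}\setminus H$ are the gaps of $H$, and the Frobenius number $F(H)$ is the largest integer not in $H$. The set of pseudo-Frobenius numbers is $PF(H)=\{f\in G(H): f+M\subseteq H\}$. $H$ is symmetric if for all $x\in\mathbb{Z}$ either $x\in H$ or $F(H)-x\in H$. Writing $PF(H)=\{f_1<\dots<f_{\tau-1}<F(H)\}$ with $\tau=|PF(H)|$, $H$ is almost symmetric if $f_i+f_{\tau-i}=F(H)$ for $i=1,\dots,\lfloor \tau/2\rfloor$. The canonical ideal of $H$ is $\Omega_H=\{-f+h : f\in PF(H),\ h\in H\}\subset\mathbb{Z}$, the anti-canonical ideal is $\Omega_H^{-1}=\{x\in\mathbb{Z}: x+\Omega_H\subseteq H\}$, and the trace of $H$ is $\operatorname{tr}(H)=\Omega_H+\Omega_H^{-1}\subseteq H$. $H$ is nearly Gorenstein if $M\subseteq\operatorname{tr}(H)$. *)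

(* Defs.v *)
From mathcomp Require Import all_boot all_order all_algebra.
From mathcomp Require Import finmap.
From mathcomp Require Import boolp classical_sets functions cardinality.

Set Implicit Arguments.
Unset Strict Implicit.
Unset Printing Implicit Defensive.

Import Order.TTheory GRing.Theory Num.Theory.

Local Open Scope classical_set_scope.
Local Open Scope ring_scope.

Definition submonoid (S : set nat) : Prop :=
  S 0%N /\ forall x y : nat, S x -> S y -> S (x + y)%N.

Definition generated (G : set nat) : set nat := smallest submonoid G.

Record numerical_semigroup := NumericalSemigroup {
  semigroup_set :> set nat;
  semigroup_submonoid : submonoid semigroup_set;
  semigroup_cofinite : finite_set (~` semigroup_set) }.

Section Invariants.
Variable H : numerical_semigroup.

Definition gaps : set nat := ~` H.

Definition maxideal : set nat := H `\ 0%N.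

Definition intset (A : set nat) : set int := Posz @` A.

(* The largest integer outside H.  The complement of H in the integers contains
   the negative integers and is bounded above, so the default value of xget is
   never used; for H = N the result is -1. *)
Definition frobenius : int :=
  xget 0 (~` intset H `&` ubound (~` intset H)).

Definition pseudo_frobenius : set nat :=
  [set f | gaps f /\ [set (f + m)%N | m in maxideal] `<=` H].

(* fset_set agrees with the set because pseudo_frobenius is finite. *)
Definition pf_seq : seq nat := sort leq (fset_set pseudo_frobenius).

Definition pf_type : nat := size pf_seq.

(* f_i, indexed from 1 as in f_1 < f_2 < ... < f_tau. *)
Definition pf_nth (i : nat) : nat := nth 0%N pf_seq i.-1.

Definition symmetric_semigroup : Prop :=
  forall x : int, intset H x \/ intset H (frobenius - x).

Definition almost_symmetric : Prop :=
  forall i : nat, (1 <= i <= pf_type./2)%N ->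
    (pf_nth i)%:Z + (pf_nth (pf_type - i)%N)%:Z = frobenius.

Definition canonical_ideal : set int :=
  [set - f%:Z + h%:Z | f in pseudo_frobenius & h in H].

Definition anticanonical_ideal : set int :=
  [set x : int | [set x + y | y in canonical_ideal] `<=` intset H].

Definition semigroup_trace : set int :=
  [set x + y | x in canonical_ideal & y in anticanonical_ideal].

Definition nearly_gorenstein : Prop := intset maxideal `<=` semigroup_trace.

End Invariants.

Definition arith_generators (a d e : nat) : set nat :=
  [set (a + i * d)%N | i in `I_e].

Lemma pseudo_frobenius_finite (H : numerical_semigroup) :
  finite_set (pseudo_frobenius H).
Proof. by apply: sub_finite_set (semigroup_cofinite H) => f []. Qed.

Lemma generated_submonoid (G : set nat) : submonoid (generated G).
Proof.
split; first by move=> A [[]].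
by move=> x y Gx Gy A GA; case: (GA) => -[_ AD] _; apply: AD; [exact: Gx|exact: Gy].
Qed.

Lemma submonoid_mul (S : set nat) (k x : nat) :
  submonoid S -> S x -> S (k * x)%N.
Proof.
move=> [S0 SD] Sx; elim: k => [//|k IHk]; rewrite mulSn; exact: SD.
Qed.

Lemma arith_cofinite (a d e : nat) :
  (1 < e)%N -> (0 < a)%N -> coprime a d ->
  finite_set (~` generated (arith_generators a d e)).
Proof.
move=> e1 a0 cad; set S := generated _.
have SM : submonoid S by exact: generated_submonoid.
have Sa : S a.
  by apply: sub_gen_smallest; exists 0%N; rewrite ?mul0n ?addn0 //=; apply: ltnW.
have Sad : S (a + d)%N by apply: sub_gen_smallest; exists 1%N; rewrite ?mul1n.
have cam : coprime a (a + d) by rewrite /coprime gcdnDl.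
apply: (@sub_finite_set _ _ `I_(a * (a + d))); last exact: finite_II.
move=> n /= Sn; rewrite ltnNge; apply/negP => le_n; apply: Sn.
have E1 := chinese_modl cam n 0; have E2 := chinese_modr cam n 0.
have /dvdnP[k Ek] : (a + d %| chinese a (a + d) n 0)%N.
  by rewrite /dvdn E2 mod0n.
have E3 : (k %% a * (a + d) = n %[mod a])%N by rewrite modnMml -Ek.
have le_k : (k %% a * (a + d) <= n)%N.
  by apply: leq_trans le_n; rewrite leq_mul2r (ltnW (ltn_pmod k a0)) orbT.
have /dvdnP[q Eq] : (a %| n - k %% a * (a + d))%N.
  by rewrite -eqn_mod_dvd //; apply/eqP.
case: (SM) => _ SD; rewrite -(subnK le_k) Eq.
by apply: SD; [exact: (submonoid_mul q SM Sa)|exact: (submonoid_mul _ SM Sad)].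
Qed.

(* <a, a+d, ..., a+(e-1)d> is a numerical semigroup. *)
Lemma arith_semigroup_exists (a d e : nat) :
  (1 < e)%N -> (0 < a)%N -> coprime a d ->
  exists H : numerical_semigroup,
    semigroup_set H = generated (arith_generators a d e).
Proof.
move=> e1 a0 cad.
by exists (NumericalSemigroup (generated_submonoid _) (arith_cofinite e1 a0 cad)).
Qed.

(* Main.v *)
(** Put k = e - 1.  Every integer is q a + j d with 0 <= j < a, and it lies in H
    iff j <= q k.  Writing a - 2 = p k + r with 0 <= r < k, the pseudo-Frobenius
    numbers are therefore the r + 1 terms of the arithmetic progression
    p a + (p k + i + 1) d, i = 0, ..., r, the last of which is F(H).  So H is
    symmetric iff r = 0, and f_i + f_(tau - i) exceeds F(H) by p (a + k d), which
    vanishes iff p = 0, i.e. a = e.  Since differences of pseudo-Frobenius numbers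
    are multiples of d bounded by r d <= k d, each generator g can be written
    - f + (f + g) with f + g in the anti-canonical ideal for a suitable f. *)

Require Import Defs.
From mathcomp Require Import all_boot all_order all_algebra.
From mathcomp Require Import boolp classical_sets functions cardinality.
From mathcomp Require Import finmap zify ring.

Set Implicit Arguments.
Unset Strict Implicit.
Unset Printing Implicit Defensive.

Import Order.TTheory GRing.Theory Num.Theory.

Local Open Scope classical_set_scope.
Local Open Scope ring_scope.

(** * Coordinates with respect to a and d *)

Lemma generated_arithP (a d k x : nat) :
  generated (arith_generators a d k.+1) x <->
  exists q j : nat, x = (q * a + j * d)%N /\ (j <= q * k)%N.
Proof.
split=> [gen_x|[q [j [-> le_j]]]].
  apply: (gen_x [set y | exists q j : nat, y = (q * a + j * d)%N /\ (j <= q * k)%N]).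
  split=> [|_ [i /= lt_i <-]]; last by exists 1%N, i; split; lia.
  split=> [|_ _ [q [j [-> le_j]]] [q' [j' [-> le_j']]]]; first by exists 0%N, 0%N.
  by exists (q + q')%N, (j + j')%N; split; [ring | rewrite mulnDl leq_add].
have [S0 SD] := generated_submonoid (arith_generators a d k.+1).
elim: q j le_j => [|q IHq] j le_j; first by have -> : j = 0%N by lia.
(* Greedy choice: the generator split off has the largest index allowed, which leaves a coefficient
   of d that is at most [q * k]. *)
have -> : (q.+1 * a + j * d = (a + minn j k * d) + (q * a + (j - minn j k) * d))%N.
  by rewrite -{1}(subnK (geq_minl j k)); ring.
apply: SD; last by apply: IHq; lia.
by apply: sub_gen_smallest; exists (minn j k) => //=; lia.
Qed.

(** Multiply a Bezout relation by [x] and reduce the coefficient of [d] modulo [a]; the quotient,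
    times [d], moves to the coefficient of [a]. *)
Lemma arith_coordinates (a d : nat) (x : int) : (0 < a)%N -> coprime a d ->
  exists (q : int) (j : nat), (j < a)%N /\ x = q * a%:Z + j%:Z * d%:Z.
Proof.
move=> a_gt0 cad.
have [u [v uv]] := Bezoutz a%:Z d%:Z.
have g1 : gcdz a d = 1 by rewrite /gcdz /= (eqP cad).
have a_neq0 : a%:Z != 0 by lia.
have r_ge0 := modz_ge0 (x * v) a_neq0.
have r_lt : ((x * v) %% a%:Z)%Z < a%:Z by apply: ltz_pmod; lia.
have E := divz_eq (x * v) a%:Z.
exists (x * u + ((x * v) %/ a%:Z)%Z * d%:Z), `|((x * v) %% a%:Z)%Z|%N.
split; first by lia.
rewrite gez0_abs //.
transitivity (x * (u * a%:Z + v * d%:Z)); first by rewrite uv g1 mulr1.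
rewrite mulrDr [x * (v * _)]mulrA {1}E; ring.
Qed.

Section ArithmeticSemigroup.

Variables (a d k : nat) (H : numerical_semigroup).
Hypotheses (k_gt1 : (1 < k)%N) (lt_ka : (k < a)%N) (cad : coprime a d).
Hypothesis defH : semigroup_set H = generated (arith_generators a d k.+1).

Let d_gt0 : (0 < d)%N.
Proof. by case: d cad => [|//]; rewrite /coprime gcdn0; lia. Qed.

Lemma intset_nat (n : nat) : intset H n%:Z <-> semigroup_set H n.
Proof. by split=> [[m Hm [<-]]|Hn] //; exists n. Qed.

(** Any representation has the form q' = q - t d, j' = j + t a. If j' >= 0, then j < a forces t >=
    0, so j <= j' <= q' k <= q k: the reduced representation is the most favourable one. *)
Lemma intset_arith (q : int) (j : nat) : (j < a)%N ->
  intset H (q * a%:Z + j%:Z * d%:Z) <-> j%:Z <= q * k%:Z.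
Proof.
move=> lt_j; split=> [[n]|le_j]; last first.
  have q_ge0 : 0 <= q by nia.
  case: q le_j q_ge0 => // q le_j _.
  exists (q * a + j * d)%N; last by lia.
  by rewrite defH; apply/generated_arithP; exists q, j; split=> //; lia.
rewrite defH => /generated_arithP[q' [j' [-> le_j']]] E.
have /dvdzP[t Et] : (a%:Z %| j'%:Z - j%:Z)%Z.
  rewrite -(@Gauss_dvdzl _ _ d%:Z) //.
  by apply/dvdzP; exists (q - q'%:Z); lia.
have t_ge0 : 0 <= t by nia.
have Eq : q = q'%:Z + t * d%:Z.
  apply: (@mulIf _ a%:Z); first by lia.
  have -> : (q'%:Z + t * d%:Z) * a%:Z = q'%:Z * a%:Z + (t * a%:Z) * d%:Z by ring.
  by rewrite -Et; lia.
have : 0 <= t * d%:Z * k%:Z by nia.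
by rewrite Eq; nia.
Qed.

(** * Frobenius and pseudo-Frobenius numbers *)

Let p := ((a - 2) %/ k)%N.
Let r := ((a - 2) %% k)%N.

Let a_eq : a = (p * k + r + 2)%N.
Proof. by rewrite /p /r -divn_eq; lia. Qed.

Let lt_rk : (r < k)%N.
Proof. by rewrite /r ltn_mod; lia. Qed.

(** The coefficient of [d] exceeds the bound [p * k] by [i.+1]; it stays below [a] exactly when
    [i <= r], and equals [a - 1] at [i = r]. *)
Definition arith_pf (i : nat) : nat := (p * a + (p * k + i.+1) * d)%N.

(** A gap satisfies q k < j <= a - 1 = p k + r + 1 <= (p + 1) k, so q <= p: both coordinates are at
    most those of [arith_pf r]. *)
Lemma frobenius_arith : frobenius H = (arith_pf r)%:Z.
Proof.
have E : (arith_pf r)%:Z = p%:Z * a%:Z + (p * k + r.+1)%N%:Z * d%:Z.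
  by rewrite /arith_pf; lia.
have notF : ~ intset H (arith_pf r)%:Z.
  by rewrite E intset_arith; lia.
have ubF x : ~ intset H x -> x <= (arith_pf r)%:Z.
  have [q [j [lt_j ->]]] := arith_coordinates x (ltn_trans (ltnW k_gt1) lt_ka) cad.
  rewrite intset_arith // E => /negP; rewrite -ltNge => lt_qk.
  have le_qp : q <= p%:Z by rewrite -ltzD1; nia.
  have : q * a%:Z <= p%:Z * a%:Z by nia.
  have : j%:Z * d%:Z <= (p * k + r.+1)%N%:Z * d%:Z by apply: ler_wpM2r; lia.
  lia.
rewrite /frobenius; case: xgetP => [y _ [notHy /(_ _ notF) leFy]|/(_ (arith_pf r))[]//].
by apply/eqP; rewrite eq_le leFy ubF.
Qed.

Lemma pseudo_frobenius_arith (f : nat) :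
  pseudo_frobenius H f <-> exists2 i, (i <= r)%N & f = arith_pf i.
Proof.
have a_gt0 : (0 < a)%N := ltn_trans (ltnW k_gt1) lt_ka.
split=> [[]|[i le_ir ->]].
  have [q [j [lt_j Ef]]] := arith_coordinates f%:Z a_gt0 cad.
  rewrite /gaps /= -intset_nat Ef intset_arith // => /negP; rewrite -ltNge => lt_qk.
  move=> sub.
  have subH i : (i <= k)%N -> intset H (f%:Z + (a + i * d)%N%:Z).
    move=> le_i; rewrite -PoszD; apply/intset_nat; apply: sub.
    exists (a + i * d)%N => //; split; last by move=> /=; lia.
    by rewrite defH; apply/generated_arithP; exists 1%N, i; split; lia.
  have step i : (i <= k)%N -> (j + i < a)%N -> (j + i)%N%:Z <= (q + 1) * k%:Z.
    move=> le_i lt_ji; apply/(intset_arith _ lt_ji).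
    have -> : (q + 1) * a%:Z + (j + i)%N%:Z * d%:Z = f%:Z + (a + i * d)%N%:Z.
      by rewrite Ef; lia.
    exact: subH.
  (* Otherwise the generator of index k would give j + k <= (q + 1) k, against q k < j. *)
  have le_ajk : (a <= j + k)%N.
    rewrite leqNgt; apply/negP => lt; have := step k (leqnn k) lt; lia.
  (* The generator of index a - 1 - j <= k raises the coefficient of [d] to a - 1. Then q k < a - 1
     <= (q + 1) k pins down q = p. *)
  have le_a1 : a%:Z - 1 <= (q + 1) * k%:Z.
    have := step (a.-1 - j)%N; lia.
  have Eq : q = p%:Z.
    have : q < p%:Z + 1 by nia.
    have : p%:Z < q + 1 by nia.
    lia.
  exists (j - (p * k).+1)%N; first by lia.
  have Ej : (p * k + (j - (p * k).+1).+1 = j)%N by nia.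
  by rewrite /arith_pf Ej; lia.
have Ei : (arith_pf i)%:Z = p%:Z * a%:Z + (p * k + i.+1)%N%:Z * d%:Z.
  by rewrite /arith_pf; lia.
split; first by rewrite /gaps /= -intset_nat Ei intset_arith; lia.
move=> _ [m [Hm /= m_neq0] <-]; apply/intset_nat.
have [q [j [lt_j Em]]] := arith_coordinates m%:Z a_gt0 cad.
move/intset_nat: Hm; rewrite Em => /(intset_arith _ lt_j) le_j.
have q_gt0 : 0 < q.
  have q_ge0 : 0 <= q by nia.
  have [q0|] := eqVneq q 0; last by lia.
  by move: Em; rewrite q0 (_ : j = 0%N); lia.
rewrite PoszD Ei Em.
(* Below [a], the coefficient is at most a - 1 <= (p + 1) k, enough since q >= 1. Otherwise [a]
   copies of [d] are traded for [d] copies of [a]. *)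
have [lt_ja|ge_ja] := ltnP (p * k + i.+1 + j) a.
  have -> : p%:Z * a%:Z + (p * k + i.+1)%N%:Z * d%:Z + (q * a%:Z + j%:Z * d%:Z) =
            (p%:Z + q) * a%:Z + (p * k + i.+1 + j)%N%:Z * d%:Z by lia.
  have le_k : k%:Z <= q * k%:Z by nia.
  by apply/(intset_arith _ lt_ja); lia.
have lt_ja : (p * k + i.+1 + j - a < a)%N by lia.
have -> : p%:Z * a%:Z + (p * k + i.+1)%N%:Z * d%:Z + (q * a%:Z + j%:Z * d%:Z) =
          (p%:Z + q + d%:Z) * a%:Z + (p * k + i.+1 + j - a)%N%:Z * d%:Z.
  by rewrite -subzn //; lia.
have dk_ge0 : 0 <= d%:Z * k%:Z by [].
by apply/(intset_arith _ lt_ja); rewrite -subzn //; lia.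
Qed.

Lemma pf_seq_arith : pf_seq H = [seq arith_pf i | i <- iota 0 r.+1].
Proof.
have pf_lt : {homo arith_pf : i j / (i < j)%N}.
  by move=> i j; rewrite /arith_pf ltn_add2l ltn_mul2r d_gt0 ltn_add2l.
have srt : sorted ltn [seq arith_pf i | i <- iota 0 r.+1].
  by apply: (homo_sorted pf_lt); exact: iota_ltn_sorted.
apply: (sorted_eq leq_trans anti_leq); first exact/sort_sorted/leq_total.
  by move: srt; rewrite ltn_sorted_uniq_leq => /andP[].
rewrite perm_sort; apply: uniq_perm; first exact: fset_uniq.
  by move: srt; rewrite ltn_sorted_uniq_leq => /andP[].
move=> f; rewrite in_fset_set; last exact: pseudo_frobenius_finite.
apply/idP/mapP => [/set_mem/pseudo_frobenius_arith[i le_i ->]|[i]].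
  by exists i => //; rewrite mem_iota; lia.
rewrite mem_iota => lt_i ->; apply/mem_set/pseudo_frobenius_arith.
by exists i => //; lia.
Qed.

Lemma pf_type_arith : pf_type H = r.+1.
Proof. by rewrite /pf_type pf_seq_arith size_map size_iota. Qed.

Lemma pf_nth_arith (i : nat) : (0 < i <= r.+1)%N -> pf_nth H i = arith_pf i.-1.
Proof.
move=> i_bnd; rewrite /pf_nth pf_seq_arith (nth_map 0%N) ?size_iota; last by lia.
by rewrite nth_iota; last lia.
Qed.

(** * Symmetry and almost symmetry *)

Lemma symmetric_arith : symmetric_semigroup H <-> r = 0%N.
Proof.
split=> [sym|r0 x].
  case: (posnP r) => // r_gt0; exfalso.
  (* The smallest pseudo-Frobenius number and its reflection r d are both gaps when r > 0. *)
  have := sym (p%:Z * a%:Z + (p * k).+1%:Z * d%:Z).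
  rewrite frobenius_arith.
  have -> : (arith_pf r)%:Z - (p%:Z * a%:Z + (p * k).+1%:Z * d%:Z) =
            0 * a%:Z + r%:Z * d%:Z by rewrite /arith_pf; lia.
  by rewrite !intset_arith; lia.
have [q [j [lt_j ->]]] := arith_coordinates x (ltn_trans (ltnW k_gt1) lt_ka) cad.
rewrite frobenius_arith.
(* Reflection sends (q, j) to (p - q, a - 1 - j). As a - 1 = p k + 1, it exchanges j <= q k with its
   negation. *)
have -> : (arith_pf r)%:Z - (q * a%:Z + j%:Z * d%:Z) =
          (p%:Z - q) * a%:Z + (a.-1 - j)%N%:Z * d%:Z.
  rewrite -subzn; last by lia.
  have -> : a.-1 = (p * k + r.+1)%N by lia.
  by rewrite /arith_pf; lia.
rewrite !intset_arith; [|lia..].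
have [le_j|lt_q] := lerP j%:Z (q * k%:Z); [by left|right].
by lia.
Qed.

Lemma almost_symmetric_arith : almost_symmetric H <-> p = 0%N \/ r = 0%N.
Proof.
rewrite /almost_symmetric pf_type_arith frobenius_arith.
have sum_pf i : (1 <= i <= (r.+1)./2)%N ->
    (pf_nth H i)%:Z + (pf_nth H (r.+1 - i))%:Z =
    (p * (a + k * d))%N%:Z + (arith_pf r)%:Z.
  move=> i_bnd; rewrite !pf_nth_arith; [|lia..].
  rewrite /arith_pf (_ : (r.+1 - i).-1.+1 = r.+1 - i)%N; last by lia.
  rewrite (_ : i.-1.+1 = i); last by lia.
  have Er : r.+1%:Z = i%:Z + (r.+1 - i)%N%:Z by lia.
  have -> : (p * a + (p * k + r.+1) * d)%N%:Z =
            p%:Z * a%:Z + (p%:Z * k%:Z + r.+1%:Z) * d%:Z by lia.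
  by rewrite Er; lia.
split=> [asym|[p0|r0] i i_bnd].
- have [r0|r_gt0] := posnP r; [by right|left].
  (* The range of indices is nonempty exactly when r > 0, and the excess does not depend on the
     index, so the first one decides. *)
  have i_bnd : (1 <= 1 <= (r.+1)./2)%N by lia.
  by have := asym 1%N i_bnd; rewrite sum_pf //; nia.
- by rewrite sum_pf // p0 mul0n add0r.
- by move: i_bnd; rewrite r0 /=; lia.
Qed.

(** * The trace *)

Lemma nearly_gorenstein_arith : nearly_gorenstein H.
Proof.
move=> _ [m [Hm /= m_neq0] <-].
have := Hm; rewrite defH => /generated_arithP[[|q] [j [Em le_j]]].
  by exfalso; apply: m_neq0; rewrite Em (_ : j = 0%N) //; lia.
pose s := minn j k.
have le_sk : (s <= k)%N by rewrite geq_minr.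
have le_sj : (s <= j)%N by rewrite geq_minl.
pose h := (q * a + (j - s) * d)%N.
have Hh : semigroup_set H h.
  by rewrite defH; apply/generated_arithP; exists q, (j - s)%N; split; rewrite // /s; lia.
have Emh : m = (a + s * d + h)%N.
  by rewrite Em /h -{1}(subnK le_sj); ring.
(* [i] is chosen so that [a + s * d + arith_pf i - arith_pf i'] is the generator
   [a + (s + i - i') * d], with [0 <= s + i - i' <= k], for every [i' <= r]. *)
pose i := (r - s)%N.
(* The canonical factor absorbs [h], so only the generator [a + s * d] has to be treated. *)
exists (- (arith_pf i)%:Z + h%:Z).
  exists (arith_pf i); last by exists h.
  by apply/pseudo_frobenius_arith; exists i => //; rewrite /i; lia.
exists ((arith_pf i)%:Z + (a + s * d)%N%:Z); last by rewrite Emh; lia.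
move=> _ [_ [_ /pseudo_frobenius_arith[i' le_i' ->] [h' Hh' <-] <-]].
(* By truncated subtraction [i + s] is max(r, s), hence at least [i'] and at most [k]. *)
have le_i'is : (i' <= i + s)%N by rewrite /i; lia.
have -> : (arith_pf i)%:Z + (a + s * d)%N%:Z + (- (arith_pf i')%:Z + h'%:Z) =
          (a + (i + s - i') * d + h')%N%:Z.
  have -> : (arith_pf i)%:Z = (arith_pf i')%:Z + (i%:Z - i'%:Z) * d%:Z.
    by rewrite /arith_pf; lia.
  have -> : i%:Z - i'%:Z = (i + s - i')%N%:Z - s%:Z by lia.
  by lia.
apply/intset_nat; rewrite defH.
have [_ SD] := generated_submonoid (arith_generators a d k.+1).
apply: SD; last by rewrite -defH.
by apply/generated_arithP; exists 1%N, (i + s - i')%N; split; rewrite /i; lia.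
Qed.

End ArithmeticSemigroup.

Local Close Scope ring_scope.
Local Close Scope classical_set_scope.

Theorem proposition1p4 (a d e : nat) (H : numerical_semigroup)
    (he : 2 < e) (had : coprime a d) (hea : e <= a)
    (hH : semigroup_set H = generated (arith_generators a d e)) :
  [/\ nearly_gorenstein H,
      symmetric_semigroup H <-> a = 2 %[mod e - 1]
    & almost_symmetric H <-> (a = e \/ a = 2 %[mod e - 1])].
Proof.
case: e he hea hH => // k k_gt1 lt_ka defH; rewrite subn1 /=.
have modE : a = 2 %[mod k] <-> (a - 2) %% k = 0.
  rewrite (rwP (@eqP _ (a %% k) _)) eqn_mod_dvd; last by lia.
  by rewrite /dvdn -(rwP eqP).
(* A zero quotient means a - 2 < k, which together with k < a leaves only a = k + 1. *)
have divE : (a - 2) %/ k = 0 <-> a = k.+1.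
  have a2 := divn_eq (a - 2) k.
  split=> [q0|->]; last by rewrite divn_small; lia.
  have : (a - 2) %% k < k by rewrite ltn_mod; lia.
  by move: a2; rewrite q0; lia.
split; first exact: nearly_gorenstein_arith defH.
  by rewrite modE; exact: symmetric_arith defH.
by rewrite modE -divE; exact: almost_symmetric_arith defH.
Qed.
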